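(* Let $\mathcal{H}$ be a Hilbert space of dimension $d$. Consider the two-sample quantum universal hypothesis testing problem: for unknown $\rho,\sigma\in\mathcal{D}(\mathcal{H})$ one is given $\sigma^{\otimes m}\otimes\rho^{\otimes n}$ and must test $H_0:\sigma=\rho$ against $H_1:\sigma\neq\rho$. Let $\alpha\in(0,1)$, $k=\min\{m,n\}$, and let $m,n\to\infty$ at the same rate (i.e. along pairs with $m/n$ and $n/m$ bounded). Allowing arbitrary (possibly entangled) measurements, there exist decision rules $M$ (depending only on $m,n,\alpha,d$) such that for all sufficiently large $m,n$: whenever $\sigma=\rho$ (for any $\rho\in\mathcal{D}(\mathcal{H})$) the probability of declaring $H_1$ is at most $\alpha$; and for every fixed pair $\rho\neq\sigma$ there is a constant $K$ such that, for all sufficiently large $m,n$, the probability $\beta$ of declaring $H_0$ satisfies $$\beta\le\exp\!\left(-\frac{k\|\rho-\sigma\|_1^2}{8}+K k^{1/2}\right).$$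
   Context: $\mathcal{D}(\mathcal{H})$ denotes the set of density operators on $\mathcal{H}$. A decision rule is a two-outcome POVM $\{E_0,E_1\}$ on $\mathcal{H}^{\otimes(m+n)}$ (outcome $0$: declare $H_0$; outcome $1$: declare $H_1$), not depending on the unknown states. The probability of declaring $H_0$ is $\mathrm{Tr}[(\sigma^{\otimes m}\otimes\rho^{\otimes n})E_0]$. $\|X\|_1=\mathrm{Tr}\sqrt{X^\dagger X}$ is the trace norm. *)

(* Defs.v *)
From HB Require Import structures.
From mathcomp Require Import all_boot all_order all_algebra.
From mathcomp Require Import complex.
From mathcomp Require Import reals sequences exp.
Set Implicit Arguments. Unset Strict Implicit. Unset Printing Implicit Defensive.
Import Order.TTheory GRing.Theory Num.Theory.
Local Open Scope ring_scope.
Local Open Scope sesquilinear_scope.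

(* Complex scalars: C := R[i] for a real field R : realType. *)

(* Positive semidefinite matrices: Hermitian with non-negative quadratic form. *)
Definition psdmx (C : numClosedFieldType) (N : nat) (A : 'M[C]_N) : Prop :=
  A = A ^t* /\ forall v : 'rV[C]_N, 0 <= (v *m A *m v ^t*) 0 0.

(* Density operators on C^d. *)
Definition density (C : numClosedFieldType) (d : nat) (rho : 'M[C]_d) : Prop :=
  psdmx rho /\ \tr rho = 1.

(* Two-outcome POVM {E0, E1}. *)
Definition povm2 (C : numClosedFieldType) (N : nat) (E0 E1 : 'M[C]_N) : Prop :=
  psdmx E0 /\ psdmx E1 /\ E0 + E1 = 1%:M.

(* Trace norm ||X||_1 = Tr sqrt(X^dagger X) = sum of square roots of the
   eigenvalues of X^dagger X (spectral decomposition from spectral.v). *)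
Definition trace_normC (C : numClosedFieldType) (N : nat) (X : 'M[C]_N) : C :=
  \sum_(i < N) sqrtC (spectral_diag (X ^t* *m X) 0 i).

(* Real-valued trace norm (the value above is a non-negative real). *)
Definition trace_norm (R : realType) (N : nat) (X : 'M[R[i]]_N) : R :=
  complex.Re (trace_normC X).

(* Basis of (C^d)^{\otimes (m+n)}: functions 'I_(m+n) -> 'I_d (tensor factors). *)
Definition tidx (d m n : nat) := {ffun 'I_(m + n) -> 'I_d}.

(* sigma^{\otimes m} \otimes rho^{\otimes n}, as a matrix in the product basis
   (enumerated by enum_val). *)
Definition tens_state (C : numClosedFieldType) (d m n : nat)
    (sigma rho : 'M[C]_d) : 'M[C]_(#|tidx d m n|) :=
  \matrix_(i, j)
    \prod_(k < m + n)
      (if (k < m)%N then sigma else rho)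
        ((enum_val i : tidx d m n) k) ((enum_val j : tidx d m n) k).

(* Main.v *)
(* For a Hermitian A with A^2 = t^2, 0 <= t < 1, let w_A act as 1 - A on each of
   the first k copies of sigma and as 1 + A on each of the first k copies of rho.
   Under the null hypothesis its mean is (1 - tr(rho A)^2)^k <= 1, so with
   W := sum_j alpha 2^-(j+1) w_(A_j) and E0 := (1 + W)^-1 the inequality E1 <= W
   bounds the type I error by alpha.  Operator antitonicity of the inverse gives
   E0 <= 2^(j+1) / alpha * w_(A_j)^-1 for every j simultaneously, although the
   w_(A_j) do not commute, and w_A^-1 is again a product operator, whose mean
   under the alternative is
     ((1 - tr(rho A)) (1 + tr(sigma A)) / (1 - t^2)^2)^k.
   For A = (e / 2) sgn(rho - sigma) with 2 e = |rho - sigma|_1 the base is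
   strictly smaller than exp(- e^2 / 2) = exp(- |rho - sigma|_1^2 / 8).  Being
   strict, the inequality survives for some member of a fixed dense sequence
   (A_j), whose index j does not depend on k. *)
Require Import Defs.
From HB Require Import structures.
From mathcomp Require Import all_boot all_order all_algebra.
From mathcomp Require Import complex.
From mathcomp Require Import reals sequences exp.
From mathcomp Require Import boolp ring lra.
Import Order.TTheory GRing.Theory Num.Theory.
Local Open Scope ring_scope.
Local Open Scope complex_scope.
Set Implicit Arguments.
Unset Strict Implicit.
Unset Printing Implicit Defensive.

(** * Positive semidefinite matrices and operator inequalities for inverses *)

Section PositiveSemidefinite.
Local Open Scope sesquilinear_scope.
Context {C : numClosedFieldType}.

Lemma adjmxM m n p (A : 'M[C]_(m, n)) (B : 'M[C]_(n, p)) :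
  (A *m B) ^t* = B ^t* *m A ^t*.
Proof. by rewrite trmx_mul map_mxM. Qed.

Lemma adjmxD m n (A B : 'M[C]_(m, n)) : (A + B) ^t* = A ^t* + B ^t*.
Proof. by rewrite linearD map_mxD. Qed.

Lemma adjmxB m n (A B : 'M[C]_(m, n)) : (A - B) ^t* = A ^t* - B ^t*.
Proof. by rewrite linearB map_mxB. Qed.

Lemma adjmxZ m n (a : C) (A : 'M[C]_(m, n)) : (a *: A) ^t* = a^* *: A ^t*.
Proof. by rewrite linearZ map_mxZ. Qed.

Lemma adjmx1 n : (1%:M : 'M[C]_n) ^t* = 1%:M.
Proof. by rewrite trmx1 map_mx1. Qed.

Lemma mulmx_adj_ge0 n (v : 'rV[C]_n) : 0 <= (v *m v ^t*) 0 0.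
Proof. by rewrite mxE sumr_ge0 // => i _; rewrite !mxE mul_conjC_ge0. Qed.

Lemma mulmx_adj_eq0 n (v : 'rV[C]_n) : (v *m v ^t*) 0 0 = 0 -> v = 0.
Proof.
rewrite mxE => /psumr_eq0P v0; apply/rowP => i; rewrite mxE.
have := v0 _ i isT; rewrite !mxE => v0i; apply/eqP; rewrite -mul_conjC_eq0.
by apply/eqP/v0i => // j _; rewrite !mxE mul_conjC_ge0.
Qed.

Lemma psdmx_gram m n (B : 'M[C]_(m, n)) : psdmx (B *m B ^t*).
Proof.
split; first by rewrite adjmxM trmxCK.
by move=> v; rewrite -!mulmxA -adjmxM mulmxA mulmx_adj_ge0.
Qed.

Lemma psdmx_congr m n (B : 'M[C]_(m, n)) (A : 'M[C]_n) :
  psdmx A -> psdmx (B *m A *m B ^t*).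
Proof.
move=> [Ah Ap]; split; first by rewrite !adjmxM trmxCK -Ah mulmxA.
by move=> v; rewrite !mulmxA -mulmxA -adjmxM.
Qed.

Lemma psdmxD n (A B : 'M[C]_n) : psdmx A -> psdmx B -> psdmx (A + B).
Proof.
move=> [Ah Ap] [Bh Bp]; split; first by rewrite adjmxD -Ah -Bh.
by move=> v; rewrite mulmxDr mulmxDl mxE addr_ge0.
Qed.

Lemma psdmxZ n (a : C) (A : 'M[C]_n) : 0 <= a -> psdmx A -> psdmx (a *: A).
Proof.
move=> a0 [Ah Ap]; split.
  by rewrite adjmxZ -Ah (conj_Creal (ger0_real a0)).
by move=> v; rewrite -scalemxAr -scalemxAl mxE mulr_ge0.
Qed.

Lemma psdmx1 n : psdmx (1%:M : 'M[C]_n).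
Proof. by rewrite -[1%:M]mulmx1 -[X in _ *m X]adjmx1; apply: psdmx_gram. Qed.

Lemma psdmx_sum n (I : Type) (r : seq I) (F : I -> 'M[C]_n) :
  (forall i, psdmx (F i)) -> psdmx (\sum_(i <- r) F i).
Proof.
move=> Fp; elim/big_rec: _ => [|i A _ Ap]; last exact: psdmxD.
by rewrite -(scale0r 1%:M); apply: psdmxZ => //; apply: psdmx1.
Qed.

Lemma psdmx_diag_ge0 n (A : 'M[C]_n) i : psdmx A -> 0 <= A i i.
Proof.
move=> [_ /(_ (delta_mx 0 i))]; rewrite -rowE trmx_delta map_delta_mx.
by rewrite -colE !mxE.
Qed.

Lemma psdmx_trace_ge0 n (A : 'M[C]_n) : psdmx A -> 0 <= \tr A.
Proof. by move=> Ap; apply: sumr_ge0 => i _; apply: psdmx_diag_ge0. Qed.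

(** Spectral theorem: [B] is the adjoint of the diagonalising unitary times the square root of the
    diagonal part. *)
Lemma psdmx_factor n (A : 'M[C]_n) :
  psdmx A -> exists B : 'M[C]_n, A = B *m B ^t*.
Proof.
move=> Ap; have [Ah _] := Ap.
have /orthomx_spectralP : A \is normalmx by apply/normalmxP; rewrite -Ah.
set V := spectralmx A; set D := diag_mx _ => AE.
have Vu : V \is unitarymx by exact: spectral_unitarymx.
rewrite invmx_unitary // in AE.
have DE : D = V *m A *m V ^t*.
  by rewrite AE !mulmxA (unitarymxP Vu) mul1mx -mulmxA (unitarymxP Vu) mulmx1.
have d0 i : 0 <= spectral_diag A 0 i.
  have := psdmx_diag_ge0 i (psdmx_congr V Ap).
  by rewrite -DE mxE eqxx mulr1n.
pose S := diag_mx (map_mx sqrtC (spectral_diag A)).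
have Sh : S ^t* = S.
  rewrite tr_diag_mx map_diag_mx; congr diag_mx; apply/rowP => i.
  by rewrite !mxE; apply: conj_Creal; rewrite ger0_real ?sqrtC_ge0.
exists (V ^t* *m S); rewrite adjmxM trmxCK Sh AE -!mulmxA; congr (_ *m _).
rewrite !mulmxA; congr (_ *m _); rewrite mulmx_diag; congr diag_mx.
by apply/rowP => i; rewrite !mxE -expr2 sqrtCK.
Qed.

(** Writing [A] as [S S^*], cyclicity of the trace leaves the trace of the congruence [S^* B S]. *)
Lemma psdmx_trace_mul_ge0 n (A B : 'M[C]_n) :
  psdmx A -> psdmx B -> 0 <= \tr (A *m B).
Proof.
move=> /psdmx_factor[S ->] Bp; rewrite -mulmxA mxtrace_mulC.
rewrite -{2}[S]trmxCK; apply: psdmx_trace_ge0.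
have := psdmx_congr (S ^t*) Bp; by rewrite trmxCK.
Qed.

Lemma psdmx_trace_le n (A B D : 'M[C]_n) :
  psdmx A -> psdmx (D - B) -> \tr (A *m B) <= \tr (A *m D).
Proof.
move=> Ap BD; rewrite -subr_ge0 -linearB -mulmxBr.
exact: psdmx_trace_mul_ge0.
Qed.

(** A row [u] of the kernel satisfies [u u^* + u W u^* = 0]; both terms are non-negative, so
    [u = 0]. *)
Lemma psdmx_unit1D n (W : 'M[C]_n) : psdmx W -> 1%:M + W \in unitmx.
Proof.
move=> [_ Wp]; rewrite -row_free_unit -kermx_eq0; apply/eqP/row_matrixP => i.
rewrite row0; set u := row i _.
have : u *m (1%:M + W) = 0 by rewrite -row_mul mulmx_ker row0.
rewrite mulmxDr mulmx1 => /(congr1 (fun w => (w *m u ^t*) 0 0)).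
rewrite mulmxDl mul0mx [X in X = _]mxE [X in _ = X]mxE => /eqP.
by rewrite paddr_eq0 ?mulmx_adj_ge0 ?Wp // => /andP[/eqP/mulmx_adj_eq0].
Qed.

Lemma psdmx_inv n (X : 'M[C]_n) : psdmx X -> psdmx (invmx X).
Proof.
move=> Xp; have [Xu|/negbTE Xu] := boolP (X \in unitmx); last first.
  (* On a singular matrix [invmx] returns its argument, which is positive by assumption. *)
  by rewrite invmx_out ?inE ?Xu.
have [Xh _] := Xp.
have ih : (invmx X) ^t* = invmx X.
  by rewrite -[RHS]mulmx1 -[1%:M]adjmx1 -(mulVmx Xu) adjmxM -Xh mulKmx.
have := psdmx_congr (invmx X) Xp.
by rewrite ih mulVmx // mul1mx.
Qed.

(** With [X = 1 + W], the difference equals [W X^-1 W]. This is the inequality [E1 <= W] behind the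
    type I bound. *)
Lemma psdmx_sub_resolvent n (W : 'M[C]_n) :
  psdmx W -> psdmx (W - (1%:M - invmx (1%:M + W))).
Proof.
move=> Wp; have Xu := psdmx_unit1D Wp; have [Wh _] := Wp.
have := psdmx_congr W (psdmx_inv (psdmxD (psdmx1 n) Wp)).
rewrite -Wh; set X := 1%:M + W in Xu *.
have -> : W = X - 1%:M by rewrite /X addrC addKr.
rewrite !(mulmxBl, mulmxBr) mulmxV // !mul1mx mulVmx // !mulmx1.
by rewrite !opprB !addrA.
Qed.

(** With [X = 1 + W], the matrix equals [X^-1 (W + W^2) X^-1], because [W + W^2 = X^2 - X]. *)
Lemma psdmx_1B_resolvent n (W : 'M[C]_n) :
  psdmx W -> psdmx (1%:M - invmx (1%:M + W)).
Proof.
move=> Wp; have Xu := psdmx_unit1D Wp; have [Wh _] := Wp.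
have Xp := psdmxD (psdmx1 n) Wp.
have [ih _] := psdmx_inv Xp.
have := psdmx_congr (invmx (1%:M + W)) (psdmxD Wp (psdmx_gram W)).
rewrite -ih -Wh -{2}[W]mulmx1 -mulmxDr.
have -> : W *m (1%:M + W) = (1%:M + W) *m (1%:M + W) - (1%:M + W).
  by rewrite -[X in _ - X]mul1mx -mulmxBl [X in _ = X *m _]addrC addKr.
by rewrite mulmxBr mulKmx // mulVmx // mulmxBl mulmxV // mul1mx.
Qed.

(** With [X = Z + Y] and [Z' = Z^-1], the difference equals [X^-1 (Y + Y Z' Y) X^-1]. No commutation
    of [Z] and [Y] enters. *)
Lemma psdmx_inv_antimono n (Z Z' Y : 'M[C]_n) :
  psdmx Z' -> psdmx Y -> Z *m Z' = 1%:M -> (Z + Y) \in unitmx ->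
  psdmx (Z + Y) -> psdmx (Z' - invmx (Z + Y)).
Proof.
move=> Z'p Yp ZZ' Xu Xp; have [Yh _] := Yp; have [ih _] := psdmx_inv Xp.
have Z'Z : Z' *m Z = 1%:M by apply: mulmx1C.
have := psdmx_congr (invmx (Z + Y)) (psdmxD Yp (psdmx_congr Y Z'p)).
rewrite -ih -Yh; set X := Z + Y in Xu *.
have -> : Y + Y *m Z' *m Y = X *m Z' *m X - X.
  have -> : Y = X - Z by rewrite /X addrC addKr.
  rewrite !(mulmxBl, mulmxBr) ZZ' !mul1mx -!mulmxA Z'Z mulmx1.
  by rewrite addrC subrK.
rewrite mulmxBr -mulmxA mulKmx // mulVmx // mulmxBl mul1mx -mulmxA mulmxV //.
by rewrite mulmx1.
Qed.

End PositiveSemidefinite.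

(** * Tensor products of matrices, their traces and positivity *)

Section TensorProduct.
Local Open Scope sesquilinear_scope.
Context {C : numClosedFieldType}.

(** Indices are enumerated as in [tens_state], which is thereby an instance by conversion alone. *)
Definition tensmx d N (F : 'I_N -> 'M[C]_d) : 'M[C]_#|{ffun 'I_N -> 'I_d}| :=
  \matrix_(i, j) \prod_(l < N)
    F l ((enum_val i : {ffun 'I_N -> 'I_d}) l)
        ((enum_val j : {ffun 'I_N -> 'I_d}) l).

Lemma tensmxM d N (F G : 'I_N -> 'M[C]_d) :
  tensmx F *m tensmx G = tensmx (fun l => F l *m G l).
Proof.
apply/matrixP => i j; rewrite !mxE.
under [RHS]eq_bigr do rewrite mxE.
(* Expanding the product of the sitewise sums gives one sum over all functions from sites to levels,
   that is, over the intermediate index of the matrix product. *)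
rewrite bigA_distr_bigA /=.
rewrite (big_enum_val (A := {ffun 'I_N -> 'I_d})) /=.
by apply: eq_bigr => f _; rewrite !mxE -big_split.
Qed.

Lemma mxtrace_tensmx d N (F : 'I_N -> 'M[C]_d) :
  \tr (tensmx F) = \prod_(l < N) \tr (F l).
Proof.
rewrite /mxtrace bigA_distr_bigA /=.
rewrite (big_enum_val (A := {ffun 'I_N -> 'I_d})) /=.
by apply: eq_bigr => f _; rewrite !mxE.
Qed.

Lemma tensmx_adj d N (F : 'I_N -> 'M[C]_d) :
  (tensmx F) ^t* = tensmx (fun l => (F l) ^t*).
Proof.
apply/matrixP => i j; rewrite !mxE rmorph_prod.
by apply: eq_bigr => l _; rewrite !mxE.
Qed.

Lemma tensmx1 d N : tensmx (fun _ : 'I_N => 1%:M : 'M[C]_d) = 1%:M.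
Proof.
apply/matrixP => i j; rewrite !mxE.
have [->|ij] := eqVneq i j; first by rewrite big1 // => l _; rewrite mxE eqxx.
have [l lP] : exists l, (enum_val i : {ffun 'I_N -> 'I_d}) l !=
                        (enum_val j : {ffun 'I_N -> 'I_d}) l.
  apply/existsP; apply: contraNT ij; rewrite negb_exists => /forallP e.
  by apply/eqP/enum_val_inj/ffunP => l; apply/eqP; have := e l; rewrite negbK.
by rewrite (bigD1 l) //= mxE (negbTE lP) mul0r.
Qed.

Lemma eq_tensmx d N (F G : 'I_N -> 'M[C]_d) : F =1 G -> tensmx F = tensmx G.
Proof.
move=> FG; apply/matrixP => i j; rewrite !mxE.
by apply: eq_bigr => l _; rewrite FG.
Qed.

(** Factoring every site as [B_l B_l^*] exhibits the tensor product as a Gram matrix. *)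
Lemma psdmx_tens d N (F : 'I_N -> 'M[C]_d) :
  (forall l, psdmx (F l)) -> psdmx (tensmx F).
Proof.
move=> Fp.
have [B FB] := fin_all_exists (fun l => psdmx_factor (Fp l)).
rewrite (eq_tensmx FB) -tensmxM -tensmx_adj.
exact: psdmx_gram.
Qed.

Lemma tens_stateE d m n (sigma rho : 'M[C]_d) :
  tens_state m n sigma rho =
  tensmx (fun l : 'I_(m + n) => if (l < m)%N then sigma else rho).
Proof. by []. Qed.

Lemma psdmx_tens_state d m n (sigma rho : 'M[C]_d) :
  psdmx sigma -> psdmx rho -> psdmx (tens_state m n sigma rho).
Proof. by move=> sp rp; apply: psdmx_tens => l; case: ifP. Qed.

(* [B] acts on the first [k] copies of sigma, [B'] on the first [k] copies of
   rho, and the remaining copies are left untouched. *)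
Definition blockmx d m n k (B B' : 'M[C]_d) : 'M[C]_#|tidx d m n| :=
  tensmx (fun l : 'I_(m + n) =>
    if (l < m)%N then if (l < k)%N then B else 1%:M
    else if (l < m + k)%N then B' else 1%:M).

Lemma blockmxM d m n k (A A' B B' : 'M[C]_d) :
  blockmx m n k A A' *m blockmx m n k B B' =
  blockmx m n k (A *m B) (A' *m B').
Proof.
by rewrite tensmxM; apply: eq_tensmx => l; do 2!case: ifP => _;
  rewrite ?mulmx1.
Qed.

Lemma blockmx1 d m n k : blockmx m n k (1%:M : 'M[C]_d) 1%:M = 1%:M.
Proof.
by rewrite -tensmx1; apply: eq_tensmx => l; do 2!case: ifP => _.
Qed.

Lemma psdmx_block d m n k (B B' : 'M[C]_d) :
  psdmx B -> psdmx B' -> psdmx (blockmx m n k B B').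
Proof.
move=> Bp Bp'; apply: psdmx_tens => l.
by do 2!case: ifP => _ //; apply: psdmx1.
Qed.

(** The trace factorises over the sites, and each untouched copy contributes a factor 1. *)
Lemma mxtrace_tens_state_block d m n k (sigma rho B B' : 'M[C]_d) :
  \tr sigma = 1 -> \tr rho = 1 -> (k <= m)%N -> (k <= n)%N ->
  \tr (tens_state m n sigma rho *m blockmx m n k B B') =
  (\tr (sigma *m B) * \tr (rho *m B')) ^+ k.
Proof.
move=> s1 r1 km kn; rewrite tens_stateE tensmxM mxtrace_tensmx.
rewrite big_split_ord /= exprMn.
have prodk p x : (k <= p)%N ->
    \prod_(i < p) (if (i < k)%N then x else 1) = x ^+ k :> C.
  move=> kp; rewrite -big_mkcond /= -(big_ord_widen _ (fun=> x)) //.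
  by rewrite prodr_const card_ord.
rewrite -(prodk m _ km) -(prodk n _ kn); congr (_ * _); apply: eq_bigr => i _.
  by rewrite ltn_ord; case: ifP => _; rewrite ?mulmx1.
rewrite ltnNge leq_addr /= ltn_add2l.
by case: ifP => _; rewrite ?mulmx1.
Qed.

Lemma mxtrace_tens_state d m n (sigma rho : 'M[C]_d) :
  \tr sigma = 1 -> \tr rho = 1 -> \tr (tens_state m n sigma rho) = 1.
Proof.
move=> s1 r1; rewrite -[tens_state _ _ _ _]mulmx1 -(blockmx1 _ _ _ 0).
by rewrite mxtrace_tens_state_block // expr0.
Qed.

End TensorProduct.

(** * The mixture test and its two error bounds *)

Section MixtureTest.
Local Open Scope sesquilinear_scope.
Context {C : numClosedFieldType}.

(* Pairs (A, t) with A = t O for a Hermitian involution O. *)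
Definition tilt d (x : 'M[C]_d * C) : Prop :=
  [/\ x.1 = x.1 ^t*, x.1 *m x.1 = (x.2 ^+ 2)%:M & 0 <= x.2 < 1].

Lemma tilt_opp d (A : 'M[C]_d) t : tilt (A, t) -> tilt (- A, t).
Proof.
move=> [/= Ah A2 t01]; split=> //=; last by rewrite mulmxN mulNmx opprK.
by rewrite -[in RHS]scaleN1r adjmxZ -Ah rmorphN rmorph1 scaleN1r.
Qed.

Lemma tilt_sqr_lt1 d (x : 'M[C]_d * C) : tilt x -> 0 < 1 - x.2 ^+ 2.
Proof. by move=> [_ _ /andP[t0 t1]]; rewrite subr_gt0 exprn_ilt1. Qed.

(** Since [(1 + A)^2 = 1 + 2 A + u], the matrix [1 + A] is half of [(1 + A)^2 + (1 - u)]. *)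
Lemma psdmx_1D d (A : 'M[C]_d) u :
  A = A ^t* -> A *m A = u%:M -> u <= 1 -> psdmx (1%:M + A).
Proof.
move=> Ah A2; rewrite -subr_ge0 => u1.
have -> : 1%:M + A = 2^-1 *: ((1%:M + A) *m (1%:M + A) ^t* +
                              (1 - u) *: 1%:M).
  rewrite adjmxD adjmx1 -Ah mulmxDl !mulmxDr !mul1mx mulmx1 A2.
  rewrite scalerBl scale1r scalemx1 addrACA addrK -addrA -mulr2n -scaler_nat.
  by rewrite scalerA mulVf ?pnatr_eq0 // scale1r.
apply: psdmxZ; first by rewrite invr_ge0 ler0n.
by apply: psdmxD; [exact: psdmx_gram | apply: psdmxZ => //; exact: psdmx1].
Qed.

Lemma psdmx_1D_tilt d (A : 'M[C]_d) t : tilt (A, t) -> psdmx (1%:M + A).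
Proof.
move=> xt; have /= := tilt_sqr_lt1 xt; rewrite subr_gt0 => /ltW.
by case: xt => /= Ah A2 _; apply: psdmx_1D.
Qed.

Lemma psdmx_1B_tilt d (A : 'M[C]_d) t : tilt (A, t) -> psdmx (1%:M - A).
Proof. by move=> /tilt_opp/psdmx_1D_tilt. Qed.

(** Up to a scalar, [1 - A] and [1 + A] are mutual inverses; this keeps the inverse of a block
    operator a block operator. *)
Lemma mulmx_1B1D_tilt d (A : 'M[C]_d) t :
  tilt (A, t) -> (1%:M - A) *m (1%:M + A) = (1 - t ^+ 2)%:M.
Proof.
move=> [/= _ A2 _]; rewrite mulmxBl !mulmxDr !mul1mx mulmx1 A2.
by rewrite opprD addrA addrK raddfB.
Qed.

Lemma mulmx_1D1B_tilt d (A : 'M[C]_d) t :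
  tilt (A, t) -> (1%:M + A) *m (1%:M - A) = (1 - t ^+ 2)%:M.
Proof. by move=> /tilt_opp/mulmx_1B1D_tilt; rewrite opprK. Qed.

(** Both bounds come from positivity of [1 + A] and [1 - A]. Allowing [u = 1] covers sign operators,
    which are not tilts. *)
Lemma density_trace_bound d (rho A : 'M[C]_d) u :
  density rho -> A = A ^t* -> A *m A = u%:M -> u <= 1 ->
  -1 <= \tr (rho *m A) <= 1.
Proof.
move=> [rp r1] Ah A2 u1.
have bound B : B = B ^t* -> B *m B = u%:M -> -1 <= \tr (rho *m B).
  move=> Bh B2; have := psdmx_trace_mul_ge0 rp (psdmx_1D Bh B2 u1).
  by rewrite mulmxDr mulmx1 raddfD /= r1 -lerBlDl sub0r.
rewrite bound // -lerN2 -raddfN -mulmxN bound ?mulmxN ?mulNmx ?opprK //.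
by rewrite -[in RHS]scaleN1r adjmxZ -Ah rmorphN rmorph1 scaleN1r.
Qed.

Lemma density_tilt_bound d (rho : 'M[C]_d) x : density rho -> tilt x ->
  -1 <= \tr (rho *m x.1) <= 1.
Proof.
move=> rd xt; have := tilt_sqr_lt1 xt; rewrite subr_gt0 => /ltW.
by case: xt => Ah A2 _; apply: density_trace_bound.
Qed.

Variables (d : nat) (x : nat -> 'M[C]_d * C) (c : nat -> C).
Hypothesis x_tilt : forall j, tilt (x j).
Hypothesis c_gt0 : forall j, 0 < c j.

(** Truncating at [minn m n] keeps the sum finite, while every fixed index [j] is eventually
    included. *)
Definition mixture m n : 'M[C]_#|tidx d m n| :=
  \sum_(j < minn m n) c j *:
    blockmx m n (minn m n) (1%:M - (x j).1) (1%:M + (x j).1).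

Definition mixture_test m n := invmx (1%:M + mixture m n).

Lemma psdmx_component m n k j :
  psdmx (c j *: blockmx m n k (1%:M - (x j).1) (1%:M + (x j).1)).
Proof.
have := x_tilt j; case: (x j) => A t /= xt.
apply: psdmxZ; first exact: ltW.
by apply: psdmx_block; [exact: psdmx_1B_tilt xt | exact: psdmx_1D_tilt xt].
Qed.

Lemma psdmx_mixture m n : psdmx (mixture m n).
Proof. by apply: psdmx_sum => j; apply: psdmx_component. Qed.

Lemma povm2_mixture m n :
  povm2 (mixture_test m n) (1%:M - mixture_test m n).
Proof.
have Wp := psdmx_mixture m n.
split; first by apply/psdmx_inv/psdmxD => //; apply: psdmx1.
by split; [exact: psdmx_1B_resolvent | rewrite addrC subrK].
Qed.

(** Replacing [E1] by the mixture leaves component means [(1 - a^2)^k], with [a] real in [[-1, 1]],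
    hence at most 1. *)
Lemma mixture_type1 m n (rho : 'M[C]_d) : density rho ->
  \tr (tens_state m n rho rho *m (1%:M - mixture_test m n)) <=
  \sum_(j < minn m n) c j.
Proof.
move=> rd; have [rp r1] := rd.
have sp := psdmx_tens_state m n rp rp.
apply: le_trans (psdmx_trace_le sp (psdmx_sub_resolvent (psdmx_mixture m n))) _.
rewrite mulmx_sumr raddf_sum; apply: ler_sum => j _ /=.
rewrite -scalemxAr mxtraceZ mxtrace_tens_state_block ?geq_minl ?geq_minr //.
rewrite ler_piMr ?(ltW (c_gt0 j)) //.
have /andP[a1 a2] := density_tilt_bound rd (x_tilt j).
rewrite mulmxBr mulmxDr mulmx1 raddfB raddfD /= r1.
apply: exprn_ile1; first by rewrite mulr_ge0 ?subr_ge0 // -lerBlDl sub0r.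
rewrite -subr_sqr expr1n gerBl real_exprn_even_ge0 //.
by rewrite (ler_real a2) rpred1.
Qed.

Lemma mixture_type2 m n (sigma rho : 'M[C]_d) j :
  density sigma -> density rho -> (j < minn m n)%N ->
  \tr (tens_state m n sigma rho *m mixture_test m n) <=
  (c j)^-1 * ((1 + \tr (sigma *m (x j).1)) * (1 - \tr (rho *m (x j).1)) /
              (1 - (x j).2 ^+ 2) ^+ 2) ^+ minn m n.
Proof.
move=> [sp s1] [rp r1] jk; set k := minn m n in jk *.
have := psdmx_component m n k j; have := x_tilt j.
have WE : mixture m n =
    c j *: blockmx m n k (1%:M - (x j).1) (1%:M + (x j).1) +
    \sum_(i < k | i != Ordinal jk)
      c i *: blockmx m n k (1%:M - (x i).1) (1%:M + (x i).1).
  by rewrite /mixture -/k (bigD1 (Ordinal jk)).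
set Y := \sum_(i < k | _) _ in WE.
(* The identity and all components other than [j] form the positive perturbation of the isolated
   component. *)
have Yp : psdmx (1%:M + Y).
  apply: psdmxD; first exact: psdmx1.
  by rewrite /Y -big_filter; apply: psdmx_sum => i; apply: psdmx_component.
have XE : 1%:M + mixture m n =
    c j *: blockmx m n k (1%:M - (x j).1) (1%:M + (x j).1) + (1%:M + Y).
  by rewrite WE addrCA.
have Xu := psdmx_unit1D (psdmx_mixture m n).
have Xp := psdmxD (psdmx1 _) (psdmx_mixture m n).
rewrite /mixture_test; move: XE Xu Xp => -> {WE}.
case: (x j) => A t /= Xu Xp xt _.
have u0 := tilt_sqr_lt1 xt; set u := 1 - t ^+ 2 in u0 *.
have ui0 : 0 <= u^-1 by rewrite invr_ge0 ltW.
(* [Z'] inverts the isolated component: the signs of [A] are exchanged and each site is divided by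
   [u = 1 - t^2]. *)
pose Z' := (c j)^-1 *: blockmx m n k (u^-1 *: (1%:M + A)) (u^-1 *: (1%:M - A)).
have Z'p : psdmx Z'.
  apply: psdmxZ; first by rewrite invr_ge0 ltW.
  apply: psdmx_block; apply: psdmxZ => //.
    exact: psdmx_1D_tilt xt.
  exact: psdmx_1B_tilt xt.
have ZZ' : (c j *: blockmx m n k (1%:M - A) (1%:M + A)) *m Z' = 1%:M.
  rewrite -scalemxAl -scalemxAr scalerA mulfV ?gt_eqF // scale1r blockmxM.
  rewrite -!scalemxAr (mulmx_1B1D_tilt xt) (mulmx_1D1B_tilt xt).
  by rewrite -/u scale_scalar_mx mulVf ?gt_eqF // blockmx1.
have tp := psdmx_tens_state m n sp rp.
apply: le_trans (psdmx_trace_le tp (psdmx_inv_antimono Z'p Yp ZZ' Xu Xp)) _.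
rewrite -scalemxAr mxtraceZ mxtrace_tens_state_block ?geq_minl ?geq_minr //.
rewrite -!scalemxAr !mxtraceZ mulmxBr mulmxDr !mulmx1 raddfB raddfD /= s1 r1.
rewrite mulrACA -invfM -expr2 [X in _ * X ^+ _]mulrC.
exact: lexx.
Qed.

End MixtureTest.

(** * A Hermitian involution attaining the trace norm *)

Section TraceNormWitness.
Local Open Scope sesquilinear_scope.
Context {C : numClosedFieldType}.

(** Commutation says [(y_i - y_j) X_ij = 0], so a nonzero entry forces [y_i = y_j], hence equal
    values of [f]. *)
Lemma diag_mx_map_comm n (f : C -> C) (X : 'M[C]_n) (y : 'rV[C]_n) :
  diag_mx y *m X = X *m diag_mx y ->
  diag_mx (map_mx f y) *m X = X *m diag_mx (map_mx f y).
Proof.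
rewrite !mul_diag_mx !mul_mx_diag => /matrixP yX; apply/matrixP => i j.
have := yX i j; rewrite !mxE [X i j * y 0 j]mulrC [X i j * f _]mulrC.
move=> /eqP; rewrite -subr_eq0 -mulrBl mulf_eq0 subr_eq0 => /orP[]/eqP->//.
by rewrite !mulr0.
Qed.

(* Since [X' ^ 2 = diag_mx y] commutes with [X'], the sign of [X'] may be built
   from functions of [y], without diagonalising [X'] itself; the kernel of [X']
   receives the sign [+1]. *)
Lemma trace_norm_witness n (X : 'M[C]_n) : X = X ^t* ->
  exists O : 'M[C]_n,
    [/\ O = O ^t*, O *m O = 1%:M, \tr (X *m O) = trace_normC X &
        0 <= trace_normC X].
Proof.
move=> Xh; rewrite /trace_normC.
have Yp := psdmx_gram (X ^t*); rewrite trmxCK in Yp.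
have [Yh _] := Yp; set Y := X ^t* *m X in Yp Yh *.
have /orthomx_spectralP : Y \is normalmx by apply/normalmxP; rewrite -Yh.
set V := spectralmx Y; set y := spectral_diag Y => YE.
have Vu : V \is unitarymx by exact: spectral_unitarymx.
rewrite invmx_unitary // in YE.
have V1 : V *m V ^t* = 1%:M by exact/unitarymxP.
have V2 : V ^t* *m V = 1%:M by exact: mulmx1C.
have DE : diag_mx y = V *m Y *m V ^t*.
  by rewrite YE !mulmxA V1 mul1mx -mulmxA V1 mulmx1.
have y0 i : 0 <= y 0 i.
  have := psdmx_diag_ge0 i (psdmx_congr V Yp).
  by rewrite -DE mxE eqxx mulr1n.
pose X' := V *m X *m V ^t*.
have X'h : X' = X' ^t* by rewrite !adjmxM trmxCK -Xh mulmxA.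
have X'2 : X' *m X' = diag_mx y.
  by rewrite DE /X' /Y -Xh !mulmxA -[X in X *m _ *m _]mulmxA V2 mulmx1.
have X'y f := diag_mx_map_comm f
  (etrans (congr1 (mulmx^~ X') (esym X'2))
          (etrans (esym (mulmxA _ _ _)) (congr1 (mulmx X') X'2))).
(* As [0^-1 = 0], [g] vanishes at 0 and [G] is the pseudo-inverse of the modulus of [X']; [H]
   projects onto the kernel, so [G H = 0]. *)
pose g (a : C) := (sqrtC a)^-1; pose h (a : C) : C := (a == 0)%:R.
set G := diag_mx (map_mx g y); set H := diag_mx (map_mx h y).
have Gh : G ^t* = G.
  rewrite tr_diag_mx map_diag_mx; congr diag_mx; apply/rowP => i.
  by rewrite !mxE; apply: conj_Creal; rewrite rpredV ger0_real ?sqrtC_ge0.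
have Hh : H ^t* = H.
  rewrite tr_diag_mx map_diag_mx; congr diag_mx; apply/rowP => i.
  by rewrite !mxE; apply: conj_Creal; rewrite realn.
have GH : G *m H = 0.
  rewrite mulmx_diag -(raddf0 (@diag_mx C n)); congr diag_mx; apply/rowP => i.
  by rewrite !mxE /g /h; case: eqP => [->|_]; rewrite ?mulr0 //
     sqrtC0 invr0 mul0r.
have HG : H *m G = 0 by rewrite diag_mxC.
pose O' := G *m X' + H.
have O'h : O' = O' ^t* by rewrite adjmxD adjmxM Gh Hh -X'h -X'y.
have O'2 : O' *m O' = 1%:M.
  have GXGX : G *m X' *m (G *m X') = G *m G *m diag_mx y.
    by rewrite mulmxA -[G *m X' *m G]mulmxA -X'y -X'2 !mulmxA.
  have GXH : G *m X' *m H = 0 by rewrite -mulmxA -X'y mulmxA GH mul0mx.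
  rewrite mulmxDl !mulmxDr GXGX GXH mulmxA HG mul0mx addr0 add0r !mulmx_diag.
  rewrite -raddfD -diag_const_mx; congr diag_mx; apply/rowP => i.
  rewrite !mxE /g /h; case: eqP => [->|/eqP yi0].
    by rewrite sqrtC0 invr0 !mul0r add0r mulr1.
  by rewrite -invfM -expr2 sqrtCK mulVf // mul0r addr0.
exists (V ^t* *m O' *m V); split.
- by rewrite !adjmxM trmxCK -O'h mulmxA.
- rewrite !mulmxA -[X in X *m _ *m _]mulmxA V1 mulmx1.
  by rewrite -[X in X *m _]mulmxA O'2 mulmx1 V2.
- rewrite mulmxA mxtrace_mulC !mulmxA -/X' mulmxDr raddfD /= mulmxA mxtrace_mulC.
  rewrite mulmxA X'2 mulmx_diag mxtrace_diag [X in _ + X]big1 ?addr0 => [|i _].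
    apply: eq_bigr => i _; rewrite !mxE /g; have [->|yi0] := eqVneq (y 0 i) 0.
      by rewrite mul0r sqrtC0.
    by rewrite -{1}[y 0 i]sqrtCK expr2 mulfK // sqrtC_eq0.
  rewrite mul_mx_diag !mxE /h; case: eqP => [yi0|_]; last by rewrite mulr0.
  (* The squared norm of row [i] of [X'] is [y_i = 0], so the kernel part [H] adds nothing to the
     trace. *)
  have /mulmx_adj_eq0/rowP/(_ i) : (row i X' *m (row i X') ^t*) 0 0 = 0.
    have := congr1 (fun Z : 'M_n => Z i i) X'2; rewrite {2}X'h !mxE yi0 eqxx.
    rewrite mul0rn => s0; rewrite -[RHS]s0.
    by apply: eq_bigr => j _; rewrite !mxE.
  by rewrite !mxE => ->; rewrite mul0r.
- by apply: sumr_ge0 => i _; rewrite sqrtC_ge0.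
Qed.

End TraceNormWitness.

(** * A countable dense family of tilts *)

Section DenseTilts.
Context {R : realType}.

(** For each of the countably many boxes with rational centre and radius, pick a point of [P] inside
    it if there is one, and [t0] otherwise. *)
Lemma countable_dense (T : Type) (I : finType) (P : T -> Prop)
    (f : T -> I -> R) (t0 : T) : P t0 ->
  exists x : nat -> T, (forall j, P (x j)) /\
    forall y, P y -> forall e : R, 0 < e ->
      exists j, forall i, `|f (x j) i - f y i| <= e.
Proof.
move=> Pt0.
pose near (q : {ffun I -> rat} * rat) t :=
  P t /\ forall i, `|f t i - ratr (q.1 i)| <= ratr q.2.
have choose q : exists t, P t /\ ((exists u, near q u) -> near q t).
  have [[u [Pu uq]]|nq] := pselect (exists u, near q u); first by exists u.
  by exists t0; split=> // /nq.
pose g q := projT1 (cid (choose q)).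
pose x j := if unpickle j is Some q then g q else t0.
exists x; split=> [j|y Py e e0].
  by rewrite /x; case: unpickle => // q; rewrite /g; case: cid => /= t [].
have e20 : 0 < e / 2 by rewrite divr_gt0.
(* A radius below [e / 2] suffices: [y] and the chosen point are both within [r] of the same
   centre. *)
have [r] := rat_in_itvoo e20.
rewrite in_itv /= => /andP[r0 re].
have [p py] : exists p : I -> rat, forall i, `|f y i - ratr (p i)| <= ratr r.
  apply: (fin_all_exists
    (P := fun i (p : rat) => `|f y i - ratr p| <= ratr r)) => i.
  have fr : f y i - ratr r < f y i + ratr r by lra.
  have [p] := rat_in_itvoo fr.
  rewrite in_itv /= => /andP[p1 p2]; exists p.
  by rewrite ler_norml; apply/andP; split; lra.
exists (pickle ([ffun i => p i], r)) => i; rewrite /x pickleK /g.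
case: cid => /= t [_ []].
  by exists y; split=> // k; rewrite ffunE.
move=> _ /(_ i) /=; rewrite ffunE => ti.
rewrite -(subrK (ratr (p i)) (f t i)) -addrA.
apply: le_trans (ler_normD _ _) _; rewrite [X in _ + X]distrC.
by have := py i; lra.
Qed.

Lemma normc_real (r : R) : `|r%:C| = `|r|%:C.
Proof. by rewrite normc_def /= expr0n addr0 sqrtr_sqr. Qed.

Lemma normc_le_ReD_Im (z : R[i]) :
  `|z| <= (`|complex.Re z| + `|complex.Im z|)%:C.
Proof.
rewrite {1}[z]complexE rmorphD /=; apply: le_trans (ler_normD _ _) _.
by rewrite normrM complexiE normCi mul1r !normc_real.
Qed.

Lemma mxtrace_mul_norm_le (C : numDomainType) d (rho B : 'M[C]_d) (e : C) :
  (forall a b, `|B a b| <= e) ->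
  `|\tr (rho *m B)| <= (\sum_a \sum_b `|rho a b|) * e.
Proof.
move=> Be; rewrite mulr_suml; apply: le_trans (ler_norm_sum _ _ _) _.
apply: ler_sum => a _; rewrite mxE mulr_suml.
apply: le_trans (ler_norm_sum _ _ _) _; apply: ler_sum => b _.
by rewrite normrM ler_wpM2l.
Qed.

(** Density is taken in the real coordinates of the entries and of [t]. The sequence is fixed before
    the states; only the index [j] depends on them. *)
Lemma dense_tilts d : exists x : nat -> 'M[R[i]]_d * R[i],
  (forall j, tilt (x j)) /\
  forall y, tilt y -> forall (rho sigma : 'M[R[i]]_d) (e : R), 0 < e ->
    exists j, [/\ `|\tr (rho *m (x j).1) - \tr (rho *m y.1)| <= e%:C,
                  `|\tr (sigma *m (x j).1) - \tr (sigma *m y.1)| <= e%:C &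
                  `|(x j).2 - y.2| <= e%:C].
Proof.
pose f (x : 'M[R[i]]_d * R[i]) (i : option ('I_d * 'I_d * bool)) : R :=
  match i with
  | None => complex.Re x.2
  | Some (a, b, true) => complex.Re (x.1 a b)
  | Some (a, b, false) => complex.Im (x.1 a b)
  end.
have t0 : tilt (0 : 'M[R[i]]_d, 0 : R[i]).
  split=> /=; first by rewrite trmx0 map_mx0.
    by rewrite mul0mx expr0n raddf0.
  by rewrite lexx ltr01.
have [x [xt xd]] := countable_dense f t0.
exists x; split=> // y yt rho sigma e e0.
pose S (r : 'M[R[i]]_d) := \sum_a \sum_b `|r a b|.
have S0 r : 0 <= S r by apply: sumr_ge0 => a _; apply: sumr_ge0.
have SE r : S r = (complex.Re (S r))%:C by rewrite RRe_real // ger0_real.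
have ReS0 r : 0 <= complex.Re (S r) by rewrite -ler0c -SE.
(* [M] dominates both entrywise 1-norms, and the added 1 gives [M >= 1]. The tolerance [e / (2 * M)]
   allows for real and imaginary parts. *)
pose M := complex.Re (S rho) + complex.Re (S sigma) + 1.
have M0 : 0 < M by have := ReS0 rho; have := ReS0 sigma; rewrite /M; lra.
have [|j xj] := xd y yt (e / (2 * M)); first by rewrite divr_gt0 ?mulr_gt0.
have entry a b : `|((x j).1 - y.1) a b| <= (e / M)%:C.
  apply: le_trans (normc_le_ReD_Im _) _; rewrite lecR !mxE !raddfB /=.
  have -> : e / M = e / (2 * M) + e / (2 * M) by field; rewrite gt_eqF.
  apply: lerD; first exact: (xj (Some (a, b, true))).
  exact: (xj (Some (a, b, false))).
have trace r : complex.Re (S r) <= M ->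
    `|\tr (r *m (x j).1) - \tr (r *m y.1)| <= e%:C.
  move=> rM; rewrite -raddfB /= -mulmxBr.
  apply: le_trans (mxtrace_mul_norm_le _ entry) _.
  rewrite -/(S r) SE -rmorphM lecR.
  by rewrite mulrCA ler_piMr ?(ltW e0) // ler_pdivrMr // mul1r.
have tilt_real (z : 'M[R[i]]_d * R[i]) : tilt z -> z.2 = (complex.Re z.2)%:C.
  by move=> [_ _ /andP[z0 _]]; rewrite RRe_real // ger0_real.
exists j; split.
- by apply: trace; have := ReS0 sigma; rewrite /M; lra.
- by apply: trace; have := ReS0 rho; rewrite /M; lra.
- rewrite (tilt_real _ (xt j)) (tilt_real _ yt) -rmorphB normc_real.
  rewrite lecR; apply: le_trans (xj None) _.
  rewrite ler_pdivrMr ?mulr_gt0 // ler_peMr ?(ltW e0) //.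
  by have := ReS0 rho; have := ReS0 sigma; rewrite /M; lra.
Qed.

End DenseTilts.

(** * The rate of the optimal tilt and its stability *)

Section ErrorExponent.
Local Open Scope sesquilinear_scope.
Context {R : realType}.

(* With [a0 = t0 r] and [b0 = t0 s], the choice [t0 = e / 2] turns the left-hand
   side into at most [(1 - t0 e) ^ 2]. *)
Lemma optimal_tilt_rate (e r s : R) : 0 < e <= 1 -> r - s = 2 * e ->
  (1 - e / 2 * r) * (1 + e / 2 * s) <
    expR (- (e ^+ 2) / 2) * (1 - (e / 2) ^+ 2) ^+ 2.
Proof.
move=> /andP[e0 e1] rs; set y := (e / 2) ^+ 2.
have y0 : 0 < y by rewrite exprn_gt0 // divr_gt0.
have y1 : y <= 1 / 4.
  have : e * e <= 1 by rewrite mulr_ile1 ?(ltW e0).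
  by rewrite /y expr2; lra.
have le1 : (1 - e / 2 * r) * (1 + e / 2 * s) <= (1 - 2 * y) ^+ 2.
  have -> : r = s + 2 * e by rewrite -rs addrC subrK.
  rewrite -subr_ge0.
  (* For fixed difference [r - s], the product is largest at [s = - e], and the deficit is a perfect
     square times [y]. *)
  have -> : (1 - 2 * y) ^+ 2 - (1 - e / 2 * (s + 2 * e)) * (1 + e / 2 * s) =
            y * (s + e) ^+ 2 by rewrite /y; field.
  by rewrite mulr_ge0 ?sqr_ge0 // ltW.
apply: le_lt_trans le1 _.
have -> : - e ^+ 2 / 2 = 2%:R * - y by rewrite /y; field.
have ey := expR_ge1Dx (- y).
rewrite expRM_natl -exprMn ltr_pXn2r ?nnegrE //; first last.
- by rewrite mulr_ge0 ?expR_ge0 //; lra.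
- lra.
(* After square roots, the chain is [1 - 2 y < (1 - y)^2 <= expR (- y) * (1 - y)]; strictness comes
   from [y^2 > 0]. *)
apply: (@lt_le_trans _ _ ((1 - y) * (1 - y))); last first.
  by rewrite ler_wpM2r //; lra.
by have := mulr_gt0 y0 y0; lra.
Qed.

Lemma tilt_rate_stable (a0 b0 t0 g : R) :
  -1 <= a0 <= 1 -> -1 <= b0 <= 1 -> 0 <= t0 < 1 -> 0 <= g <= 1 ->
  (1 - a0) * (1 + b0) < g * (1 - t0 ^+ 2) ^+ 2 ->
  exists2 h : R, 0 < h & forall a b t : R,
    `|a - a0| <= h -> `|b - b0| <= h -> `|t - t0| <= h ->
    -1 <= a <= 1 -> -1 <= b <= 1 -> 0 <= t < 1 ->
    (1 + b) * (1 - a) / (1 - t ^+ 2) ^+ 2 <= g.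
Proof.
move=> /andP[a1 a2] /andP[b1 b2] /andP[t1 t2] /andP[g1 g2] lt.
pose w := g * (1 - t0 ^+ 2) ^+ 2 - (1 - a0) * (1 + b0).
have w0 : 0 < w by rewrite subr_gt0.
(* The numerator grows by at most [5 h] and the squared denominator drops by at most [6 h], which
   the slack [w] absorbs. The cap 1 gives [h * h <= h]. *)
exists (Num.min 1 (w / 11)) => [|a b t].
  by rewrite lt_min ltr01 divr_gt0.
have : Num.min 1 (w / 11) <= 1 /\ Num.min 1 (w / 11) <= w / 11.
  by rewrite !ge_min !lexx orbT.
have : 0 < Num.min 1 (w / 11) by rewrite lt_min ltr01 divr_gt0.
move: (Num.min _ _) => h h0 [h1 hw].
rewrite !ler_norml => /andP[ha _] /andP[_ hb] /andP[_ ht].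
move=> /andP[a1' a2'] /andP[b1' b2'] /andP[t1' t2'].
have u1 : 1 - t0 ^+ 2 <= 1 by rewrite gerBl sqr_ge0.
have u'1 : 1 - t ^+ 2 <= 1 by rewrite gerBl sqr_ge0.
have u0 : 0 < 1 - t0 ^+ 2 by rewrite subr_gt0 exprn_ilt1.
have u'0 : 0 < 1 - t ^+ 2 by rewrite subr_gt0 exprn_ilt1.
have uu' : (1 - t0 ^+ 2) - (1 - t ^+ 2) <= 3 * h.
  have : t ^+ 2 <= (t0 + h) ^+ 2 by rewrite ler_pXn2r ?nnegrE //; lra.
  have : t0 * h <= h by rewrite ler_piMl // ltW.
  have : h * h <= h by rewrite ler_piMl // ltW.
  by rewrite sqrrD expr2 [h ^+ 2]expr2 mulr2n; lra.
rewrite ler_pdivrMr ?exprn_gt0 //.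
have num : (1 + b) * (1 - a) <= (1 - a0) * (1 + b0) + 5 * h.
  have : (1 + b) * (1 - a) <= (1 + b0 + h) * (1 - a0 + h).
    by apply: ler_pM; lra.
  have : (1 - a0) * h <= 2 * h by rewrite ler_wpM2r ?(ltW h0) //; lra.
  have : (1 + b0) * h <= 2 * h by rewrite ler_wpM2r ?(ltW h0) //; lra.
  have : h * h <= h by rewrite ler_piMl // ltW.
  by rewrite !mulrDl !mulrDr !mul1r !mulr1; lra.
have den : (1 - t0 ^+ 2) ^+ 2 - (1 - t ^+ 2) ^+ 2 <= 6 * h.
  rewrite subr_sqr; have [uu|uu] := leP 0 ((1 - t0 ^+ 2) - (1 - t ^+ 2)).
    by have : (1 - t0 ^+ 2 - (1 - t ^+ 2)) * (1 - t0 ^+ 2 + (1 - t ^+ 2)) <=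
              (3 * h) * 2; [apply: ler_pM|]; lra.
  by apply: le_trans (_ : 0 <= _); rewrite ?nmulr_rle0 //; lra.
have : g * ((1 - t0 ^+ 2) ^+ 2 - (1 - t ^+ 2) ^+ 2) <= 6 * h.
  have [uu|/ltW uu] := leP 0 ((1 - t0 ^+ 2) ^+ 2 - (1 - t ^+ 2) ^+ 2).
    by apply: le_trans den; rewrite ler_piMl.
  by apply: le_trans (_ : 0 <= _); rewrite ?mulr_ge0_le0 //; lra.
by rewrite mulrBr /w in hw *; lra.
Qed.

(** The tilt is [e / 2] times the involution attaining the trace norm, with [e = T / 2]; then
    [r - s = T = 2 e], and [r, s] in [[-1, 1]] force [e <= 1]. *)
Lemma trace_norm_tilt d (rho sigma : 'M[R[i]]_d) :
  density rho -> density sigma -> 0 < trace_norm (rho - sigma) ->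
  exists y : 'M[R[i]]_d * R[i], tilt y /\
  exists a b t : R,
    [/\ \tr (rho *m y.1) = a%:C, \tr (sigma *m y.1) = b%:C, y.2 = t%:C &
        (1 - a) * (1 + b) <
          expR (- (trace_norm (rho - sigma) ^+ 2) / 8) * (1 - t ^+ 2) ^+ 2].
Proof.
move=> rd sd T0; set T := trace_norm _ in T0 *.
have Xh : rho - sigma = (rho - sigma) ^t*.
  by rewrite adjmxB; case: rd => [[<- _] _]; case: sd => [[<- _] _].
have [O [Oh O2 XO T_ge0]] := trace_norm_witness Xh.
have TE : trace_normC (rho - sigma) = T%:C by rewrite RRe_real ?ger0_real.
have bound r : density r -> exists2 x : R, \tr (r *m O) = x%:C & -1 <= x <= 1.
  move=> rD; have /andP[] := density_trace_bound rD Oh O2 (lexx 1).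
  move: (\tr _) => z z1 z2.
  have zR : z \is Num.real by rewrite (ler_real z2) rpred1.
  exists (complex.Re z); first by rewrite RRe_real.
  by rewrite -!lecR RRe_real // rmorphN rmorph1 z1.
have [r rE r1] := bound _ rd; have [s sE s1] := bound _ sd.
have rsT : r - s = T.
  apply: complexI; rewrite (raddfB (real_complex R)) /=.
  by rewrite -TE -XO mulmxBl [RHS]raddfB /= rE sE.
pose e := T / 2; have rs : r - s = 2 * e by rewrite rsT /e; field.
have e01 : 0 < e <= 1.
  by move: r1 s1 => /andP[? ?] /andP[? ?]; apply/andP; split; rewrite /e; lra.
exists ((e / 2)%:C *: O, (e / 2)%:C); split.
  split=> /=.
  - rewrite adjmxZ -Oh; congr (_ *: _).
    by apply/esym/conj_Creal/complex_realP; exists (e / 2).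
  - by rewrite -scalemxAl -scalemxAr scalerA O2 scalemx1 expr2.
  - by rewrite ler0c -(rmorph1 (real_complex R)) ltcR; apply/andP; split; lra.
exists (e / 2 * r), (e / 2 * s), (e / 2); split=> //=.
- by rewrite -scalemxAr mxtraceZ rE [RHS]rmorphM.
- by rewrite -scalemxAr mxtraceZ sE [RHS]rmorphM.
- have -> : - T ^+ 2 / 8 = - e ^+ 2 / 2 by rewrite /e; field.
  exact: optimal_tilt_rate.
Qed.

End ErrorExponent.

(** * Summable weights and assembly of the universal test *)

Lemma sum_half_powers_le1 (R : realFieldType) k :
  \sum_(j < k) (2 ^+ j.+1)^-1 <= 1 :> R.
Proof.
suff -> : \sum_(j < k) (2 ^+ j.+1)^-1 = 1 - (2 ^+ k)^-1 :> R.
  by rewrite gerBl invr_ge0 exprn_ge0.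
elim: k => [|k IH]; first by rewrite big_ord0 expr0 invr1 subrr.
rewrite big_ord_recr /= IH exprS; field.
by rewrite expf_neq0 // pnatr_eq0.
Qed.

Lemma trace_norm_ge0 (R : realType) d (rho sigma : 'M[R[i]]_d) :
  density rho -> density sigma -> 0 <= trace_norm (rho - sigma).
Proof.
move=> [[rh _] _] [[sh _] _].
have [|O [_ _ _]] := trace_norm_witness (X := rho - sigma).
  by rewrite adjmxB -rh -sh.
by rewrite lecE => /andP[].
Qed.

Theorem theorem7 (R : realType) (d : nat) (alpha : R) :
  (0 < d)%N -> 0 < alpha < 1 ->
  exists M : forall m n : nat,
      'M[R[i]]_(#|tidx d m n|) * 'M[R[i]]_(#|tidx d m n|),
    (forall m n, povm2 (M m n).1 (M m n).2) /\
    forall c : nat,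
      (* regime: m, n -> oo with m <= c n and n <= c m *)
      (exists N0 : nat, forall m n : nat,
          (N0 <= m)%N -> (N0 <= n)%N -> (m <= c * n)%N -> (n <= c * m)%N ->
          forall rho : 'M[R[i]]_d, density rho ->
            \tr (tens_state m n rho rho *m (M m n).2) <= alpha%:C) /\
      (forall rho sigma : 'M[R[i]]_d, density rho -> density sigma ->
          rho <> sigma ->
          exists K : R, exists N1 : nat, forall m n : nat,
            (N1 <= m)%N -> (N1 <= n)%N -> (m <= c * n)%N -> (n <= c * m)%N ->
            let k := minn m n in
            \tr (tens_state m n sigma rho *m (M m n).1)
              <= (expR (- (k%:R * trace_norm (rho - sigma) ^+ 2) / 8
                        + K * Num.sqrt (k%:R)))%:C).
Proof.
move=> _ /andP[alpha0 _]; have [x [xt xd]] := @dense_tilts R d.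
(* Partial sums of these weights stay below [alpha], so the level holds for all [m] and [n], and
   [N0 = 0] works. *)
pose w j : R := alpha / 2 ^+ j.+1.
have w0 j : 0 < w j by rewrite divr_gt0 // exprn_gt0.
have wC j : 0 < (w j)%:C by rewrite -(rmorph0 (real_complex R)) ltcR.
pose E0 := mixture_test x (fun j => (w j)%:C).
have E_povm m n : povm2 (E0 m n) (1%:M - E0 m n) by exact: povm2_mixture.
exists (fun m n => (E0 m n, 1%:M - E0 m n)); split=> // c; split.
  exists 0%N => m n _ _ _ _ rho rd /=.
  apply: le_trans (mixture_type1 xt wC m n rd) _.
  rewrite -rmorph_sum lecR -mulr_sumr ler_piMr ?(ltW alpha0) //.
  exact: sum_half_powers_le1.
move=> rho sigma rd sd _; set T := trace_norm _.
(* If [T = 0], the bound with [K = 0] is [expR 0 = 1], which holds for any probability. *)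
have [T0|T0] := eqVneq T 0.
  exists 0, 0%N => m n _ _ _ _ /=.
  rewrite T0 expr0n mulr0 oppr0 !mul0r addr0 expR0 rmorph1.
  have [rp r1] := rd; have [sp s1] := sd; have [_ [E1p _]] := E_povm m n.
  have := psdmx_trace_mul_ge0 (psdmx_tens_state m n sp rp) E1p.
  by rewrite mulmxBr mulmx1 raddfB /= mxtrace_tens_state // subr_ge0.
have {}T0 : 0 < T by rewrite lt_def T0 trace_norm_ge0.
have [y [yt [a [b [t [ya yb yt2 rate]]]]]] := trace_norm_tilt rd sd T0.
have real_bound (r : 'M[R[i]]_d) (z : 'M[R[i]]_d * R[i]) :
    density r -> tilt z ->
    \tr (r *m z.1) = (complex.Re (\tr (r *m z.1)))%:C /\
    -1 <= complex.Re (\tr (r *m z.1)) <= 1.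
  move=> rD zt; have /andP[] := density_tilt_bound rD zt.
  move: (\tr _) => v v1 v2.
  have vR : v \is Num.real by rewrite (ler_real v2) rpred1.
  by rewrite -!lecR !RRe_real // rmorphN rmorph1 v1.
have real_tilt (z : 'M[R[i]]_d * R[i]) : tilt z ->
    z.2 = (complex.Re z.2)%:C /\ 0 <= complex.Re z.2 < 1.
  move=> [_ _ /andP[z0 z1]]; have zR := RRe_real (ger0_real z0).
  by split; rewrite // -!lecR -ltcR zR z0.
have [_] := real_bound rho y rd yt; rewrite ya /= => a1.
have [_] := real_bound sigma y sd yt; rewrite yb /= => b1.
have [_] := real_tilt y yt; rewrite yt2 /= => t1.
set g := expR _ in rate.
have g1 : 0 <= g <= 1.
  rewrite expR_ge0 -expR0 ler_expR.
  by rewrite mulNr oppr_le0 divr_ge0 ?sqr_ge0.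
have [h h0 stable] := tilt_rate_stable a1 b1 t1 g1 rate.
(* This [j] is chosen from the two states alone, so the weight [w j] is a constant as [m] and [n]
   grow. *)
have [j [ja jb jt]] := xd _ yt rho sigma h h0.
have [raE ra1] := real_bound rho (x j) rd (xt j).
have [sbE sb1] := real_bound sigma (x j) sd (xt j).
have [tE t1'] := real_tilt (x j) (xt j).
rewrite raE ya -rmorphB normc_real lecR in ja.
rewrite sbE yb -rmorphB normc_real lecR in jb.
rewrite tE yt2 -rmorphB normc_real lecR in jt.
have := stable _ _ _ ja jb jt ra1 sb1 t1'.
set q := _ / _ => qg.
have q0 : 0 <= q.
  move: ra1 sb1 => /andP[? ?] /andP[? ?].
  by rewrite divr_ge0 ?sqr_ge0 // mulr_ge0 //; lra.
(* The threshold [j.+1] puts component [j] into the mixture and ensures [k >= 1]. *)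
exists (w j)^-1, j.+1 => m n jm jn _ _ /=.
have jk : (j < minn m n)%N by rewrite leq_min jm.
apply: le_trans (mixture_type2 xt wC sd rd jk) _; set k := minn m n in jk *.
rewrite raE sbE tE.
have -> : ((1 + (complex.Re (\tr (sigma *m (x j).1)))%:C) *
          (1 - (complex.Re (\tr (rho *m (x j).1)))%:C) /
          (1 - (complex.Re (x j).2)%:C ^+ 2) ^+ 2) = q%:C.
  by rewrite fmorph_div rmorphM rmorphXn !rmorphB rmorphD rmorphXn rmorph1.
rewrite -fmorphV -rmorphXn -rmorphM lecR expRD mulrC.
apply: ler_pM; rewrite ?exprn_ge0 ?invr_ge0 ?(ltW (w0 j)) //.
  have -> : - (k%:R * T ^+ 2) / 8 = k%:R * (- (T ^+ 2) / 8) by field.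
  by rewrite expRM_natl ler_pXn2r ?nnegrE ?expR_ge0 // (leq_trans _ jk).
(* The constant prefactor is absorbed into the correction: [K <= K sqrt k <= expR (K sqrt k)], by
   [k >= 1] and [1 + z <= expR z]. *)
apply: (@le_trans _ _ ((w j)^-1 * Num.sqrt k%:R)).
  rewrite ler_peMr ?invr_ge0 ?(ltW (w0 j)) //.
  rewrite -[X in X <= _](sqrtr1 R) ler_wsqrtr // ler1n.
  exact: leq_trans jk.
by apply: le_trans (expR_ge1Dx _); rewrite lerDr.
Qed.
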